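(* Let $A$ be a finite alphabet. For all words $x,y\in A^*$, all integers $k\ge 0$ and all letters $a_1,\ldots,a_k\in A$, we have $$\binom{xy}{a_1\cdots a_k}_q=\sum_{j=0}^k q^{\,j(|y|-k+j)}\binom{x}{a_1\cdots a_j}_q\binom{y}{a_{j+1}\cdots a_k}_q .$$
   Context: $A^*$ is the free monoid of finite words over $A$ (with concatenation and empty word $\varepsilon$), and $|w|$ is the length of a word $w$. The $q$-binomial coefficient $\binom{u}{v}_q\in\mathbb{N}[q]$ of two words $u,v\in A^*$ is defined recursively by $\binom{u}{\varepsilon}_q=1$, $\binom{\varepsilon}{v}_q=0$ if $v\neq\varepsilon$, and, for all $u,v\in A^*$ and letters $a,b\in A$, $\binom{ua}{vb}_q=q^{|vb|}\binom{u}{vb}_q+\delta_{a,b}\binom{u}{v}_q$, where $\delta_{a,b}$ is the Kronecker delta. The empty product of letters is $\varepsilon$. The identity is read in $\mathbb{Z}[q,q^{-1}]$; whenever an exponent of $q$ in the sum is negative, the corresponding term is zero because a $q$-binomial factor vanishes. *)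

(* Defs.v *)
From mathcomp Require Import all_boot all_order all_algebra.
Set Implicit Arguments.
Unset Strict Implicit.
Unset Printing Implicit Defensive.
Import GRing.Theory.
Local Open Scope ring_scope.

Section QBinomial.
Variable A : eqType.

(* The recursion strips the LAST letters of the words, so it is run here on the
   reversed words; see qbin_rcons for the recurrence in its usual form. *)
Fixpoint qbin_rev (u v : seq A) {struct u} : {poly nat} :=
  match u, v with
  | _, [::] => 1
  | [::], _ :: _ => 0
  | a :: u', b :: v' =>
      'X^(size v) * qbin_rev u' v + (a == b)%:R * qbin_rev u' v'
  end.

Definition qbin (u v : seq A) : {poly nat} := qbin_rev (rev u) (rev v).

Lemma qbin0r (u : seq A) : qbin u [::] = 1.
Proof. by rewrite /qbin; case: (rev u). Qed.

Lemma qbin0l (v : seq A) : v != [::] -> qbin [::] v = 0.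
Proof. by case/lastP: v => // v b _; rewrite /qbin rev_rcons. Qed.

Lemma qbin_rcons (u v : seq A) (a b : A) :
  qbin (rcons u a) (rcons v b) =
  'X^(size (rcons v b)) * qbin u (rcons v b) + (a == b)%:R * qbin u v.
Proof. by rewrite /qbin !rev_rcons /= size_rev size_rcons. Qed.

End QBinomial.

(* Z[q, q^-1] is viewed inside its field of fractions Q(q) = Frac(Z[q]); an
   equality of Laurent polynomials is the same thing in either ring. *)
Definition Qq : fieldType := {fraction {poly int}}.

Definition qvar : Qq := tofrac ('X : {poly int}).

Definition of_Nq (p : {poly nat}) : Qq := tofrac (map_poly Posz p).

(* Main.v *)
Require Import Defs.
From mathcomp Require Import all_boot all_order all_algebra.
From mathcomp Require Import ring.
Import GRing.Theory.
Local Open Scope ring_scope.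

(* Induction on y from the right: the defining recurrence applied to the last
   letter of y turns the summand of index j for y c into q^k times the summand
   for y plus the corresponding summand for the word a_1 ... a_(k-1). *)

Lemma qbin_cat (A : eqType) (F : fieldType) (f : {rmorphism {poly nat} -> F})
    (x y v : seq A) : f 'X != 0 ->
  f (qbin (x ++ y) v) =
  \sum_(j < (size v).+1)
    f 'X ^ (j%:Z * ((size y)%:Z - (size v)%:Z + j%:Z))
    * f (qbin x (take j v)) * f (qbin y (drop j v)).
Proof.
move=> q0; elim/last_ind: y v => [|y c IHy] v.
  rewrite cats0 big_ord_recr /= big1 => [|j _].
    rewrite take_size drop_size qbin0r rmorph1 mulr1 add0r.
    by rewrite sub0r addNr mulr0 expr0z mul1r.
  rewrite qbin0l ?rmorph0 ?mulr0 //.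
  by rewrite -size_eq0 size_drop subn_eq0 -ltnNge ltn_ord.
case/lastP: v => [|v b].
  by rewrite big_ord1 !qbin0r rmorph1 !mulr1 mul0r expr0z.
rewrite -rcons_cat qbin_rcons !rmorphD !rmorphM /= rmorphXn rmorph_nat !IHy.
rewrite !size_rcons big_ord_recr [in RHS]big_ord_recr /= mulrDr !mulr_sumr.
rewrite addrAC -big_split /=; congr (_ + _); last first.
  rewrite -(size_rcons v b) take_size drop_size !qbin0r !mulrA exprnP -expfzDr //.
  by congr (_ ^ _ * _ * _); ring.
apply: eq_bigr => j _.
have lej : (j <= size v)%N by rewrite -ltnS ltn_ord.
rewrite drop_rcons // -cats1 takel_cat //.
rewrite qbin_rcons rmorphD !rmorphM /= rmorphXn rmorph_nat size_rcons size_drop.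
have Eq : f 'X ^+ (size v).+1 * f 'X ^ (j%:Z * ((size y)%:Z - (size v).+1%:Z + j%:Z))
   = f 'X ^ (j%:Z * ((size y).+1%:Z - (size v).+1%:Z + j%:Z))
     * f 'X ^+ (size v - j).+1.
  rewrite !exprnP -!expfzDr //; congr (_ ^ _).
  by rewrite !intS -subzn //; ring.
rewrite !mulrA Eq.
have -> : (size y).+1%:Z - (size v).+1%:Z = (size y)%:Z - (size v)%:Z :> int.
  by rewrite !intS; ring.
by ring.
Qed.

Theorem corollary3p3 (A : finType) (x y : seq A) (k : nat) (a : k.-tuple A) :
  of_Nq (qbin (x ++ y) a) =
  \sum_(j < k.+1)
    qvar ^ (j%:Z * ((size y)%:Z - k%:Z + j%:Z))
    * of_Nq (qbin x (take j a)) * of_Nq (qbin y (drop j a)).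
Proof.
pose f : {rmorphism {poly nat} -> Qq} := @tofrac {poly int} \o map_poly Posz.
have fX : f 'X = qvar by rewrite /f /= map_polyX.
have q0 : f 'X != 0 by rewrite fX tofrac_eq0 polyX_eq0.
by have := qbin_cat A Qq f x y a q0; rewrite fX size_tuple.
Qed.
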